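(* Let $\mathcal S_{31}(q)=F_{0,0}(q)+q^2F_{3,31}(q)-q^{22}F_{16,93}(q)$. Then $$\mathcal S_{31}(q)=F_{0,0}(q)+q^2F_{5,31}(q)+q^8F_{9,62}(q)+q^9F_{11,62}(q).$$ In particular, $\mathcal S_{31}\in\mathbb Z_{\ge 0}[[q]]$.
   Context: Here $(x;q)_n=\prod_{j=0}^{n-1}(1-xq^j)$ and, for $a,b\in\mathbb Q$, $$F_{a,b}(q)=\sum_{r,s\ge 0}\frac{q^{3r^2+31rs+93s^2+ar+bs}}{(q;q)_r\,(q^{31};q^{31})_s}.$$ *)

(* Defs.v *)
From HB Require Import structures.
From mathcomp Require Import all_boot all_order all_algebra.
From mathcomp Require Import boolp zify.

Set Implicit Arguments.
Unset Strict Implicit.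
Unset Printing Implicit Defensive.

Import Order.TTheory GRing.Theory Num.Theory.
Local Open Scope ring_scope.

(* The ring Z[[q]]. A series a coerces to its coefficient function: a n is the
   coefficient of q^n. *)
Record zseries := ZSeries { zcoef :> nat -> int }.

Lemma zseriesP (a b : zseries) : (forall n, a n = b n) -> a = b.
Proof. by case: a b => a [b] /= /funext ->. Qed.

HB.instance Definition _ := gen_eqMixin zseries.
HB.instance Definition _ := gen_choiceMixin zseries.

Definition zs0 := ZSeries (fun _ => 0).
Definition zsopp (a : zseries) := ZSeries (fun n => - a n).
Definition zsadd (a b : zseries) := ZSeries (fun n => a n + b n).

Lemma zsaddA : associative zsadd.
Proof. by move=> a b c; apply: zseriesP => n /=; rewrite addrA. Qed.
Lemma zsaddC : commutative zsadd.
Proof. by move=> a b; apply: zseriesP => n /=; rewrite addrC. Qed.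
Lemma zsadd0 : left_id zs0 zsadd.
Proof. by move=> a; apply: zseriesP => n /=; rewrite add0r. Qed.
Lemma zsaddN : left_inverse zs0 zsopp zsadd.
Proof. by move=> a; apply: zseriesP => n /=; rewrite addNr. Qed.

HB.instance Definition _ :=
  GRing.isZmodule.Build zseries zsaddA zsaddC zsadd0 zsaddN.

Definition zs1 := ZSeries (fun n => (n == 0%N)%:R).
Definition zsmul (a b : zseries) :=
  ZSeries (fun n => \sum_(i < n.+1) a i * b (n - i)%N).

Definition zstrunc (N : nat) (a : zseries) : {poly int} := \poly_(i < N.+1) a i.

Lemma coef_zstrunc N a n : (n <= N)%N -> (zstrunc N a)`_n = a n.
Proof. by move=> nN; rewrite coef_poly ltnS nN. Qed.

Lemma zsmul_trunc N a b n : (n <= N)%N ->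
  zsmul a b n = (zstrunc N a * zstrunc N b)`_n.
Proof.
move=> nN; rewrite coefM; apply: eq_bigr => i _.
have iN : (i <= N)%N by rewrite (leq_trans _ nN) // -ltnS.
by rewrite !coef_zstrunc // (leq_trans (leq_subr _ _) nN).
Qed.

Lemma zsmulA : associative zsmul.
Proof.
move=> a b c; apply: zseriesP => n.
transitivity (zstrunc n a * (zstrunc n b * zstrunc n c))`_n.
  rewrite coefM; apply: eq_bigr => i _.
  by rewrite (@zsmul_trunc n) ?leq_subr // coef_zstrunc // -ltnS.
rewrite mulrA coefM; apply: eq_bigr => i _.
by rewrite (@zsmul_trunc n) ?coef_zstrunc ?leq_subr // -ltnS.
Qed.
Lemma zsmulC : commutative zsmul.
Proof. by move=> a b; apply: zseriesP => n; rewrite !(@zsmul_trunc n) // mulrC. Qed.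
Lemma zsmul1 : left_id zs1 zsmul.
Proof.
move=> a; apply: zseriesP => n /=.
rewrite big_ord_recl big1 /= ?mul1r ?subn0 ?addr0 // => i _.
by rewrite mul0r.
Qed.
Lemma zsmulDl : left_distributive zsmul zsadd.
Proof.
move=> a b c; apply: zseriesP => n /=; rewrite -big_split /=.
by apply: eq_bigr => i _; rewrite mulrDl.
Qed.
Lemma zs1_neq0 : zs1 != 0.
Proof. by apply/eqP => /(congr1 (fun a : zseries => a 0%N)). Qed.

HB.instance Definition _ := GRing.Zmodule_isComNzRing.Build zseries
  zsmulA zsmulC zsmul1 zsmulDl zs1_neq0.

Lemma zcoef0 n : (0 : zseries) n = 0. Proof. by []. Qed.
Lemma zcoef1 n : (1 : zseries) n = (n == 0%N)%:R. Proof. by []. Qed.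
Lemma zcoefD (a b : zseries) n : (a + b) n = a n + b n. Proof. by []. Qed.
Lemma zcoefN (a : zseries) n : (- a) n = - a n. Proof. by []. Qed.
Lemma zcoefB (a b : zseries) n : (a - b) n = a n - b n. Proof. by []. Qed.
Lemma zcoefM (a b : zseries) n :
  (a * b) n = \sum_(i < n.+1) a i * b (n - i)%N.
Proof. by []. Qed.
Lemma zcoef_sum (I : Type) (s : seq I) (P : pred I) (f : I -> zseries) n :
  (\sum_(i <- s | P i) f i) n = \sum_(i <- s | P i) f i n.
Proof. by elim/big_rec2: _ => // i x y _ <-. Qed.

Lemma zcoefM0 (a b : zseries) : (a * b) 0%N = a 0%N * b 0%N.
Proof. by rewrite zcoefM big_ord1. Qed.

Lemma zcoefM_small (a b : zseries) (k l : nat) :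
  (forall n, (n < k)%N -> a n = 0) -> (forall n, (n < l)%N -> b n = 0) ->
  forall n, (n < k + l)%N -> (a * b) n = 0.
Proof.
move=> a0 b0 n nkl; rewrite zcoefM big1 // => i _.
have [ik|ki] := ltnP i k; first by rewrite a0 ?mul0r.
by rewrite b0 ?mulr0 //; have := ltn_ord i; lia.
Qed.

Lemma zcoefX_small (a : zseries) : a 0%N = 0 ->
  forall k n, (n < k)%N -> (a ^+ k) n = 0.
Proof.
move=> a0; elim=> [//|k IHk] n nk.
by rewrite exprS (@zcoefM_small _ _ 1 k) //; case.
Qed.

Definition zsunit : {pred zseries} := fun a => a 0%N \is a GRing.unit.

Definition zsconst (c : int) := ZSeries (fun n => c *+ (n == 0%N)).
Definition zsgeom (b : zseries) :=
  ZSeries (fun n => (\sum_(k < n.+1) b ^+ k) n).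
(* For a unit u of Z (u = 1 or u = -1), 1/a = u^-1 \sum_k (1 - u^-1 a)^k with
   u the constant term of a; only k <= n contributes to the coefficient n. *)
Definition zsinv (a : zseries) : zseries :=
  if a \in zsunit then
    zsconst (a 0%N)^-1 * zsgeom (1 - zsconst (a 0%N)^-1 * a)
  else a.

Lemma zsgeom_coef (b : zseries) N n : b 0%N = 0 -> (n < N)%N ->
  zsgeom b n = (\sum_(k < N) b ^+ k) n.
Proof.
move=> b0 nN; rewrite -(subnKC nN) big_split_ord zcoefD.
rewrite [X in _ + X]zcoef_sum [X in _ + X]big1 ?addr0 // => i _.
by rewrite zcoefX_small //= addSn ltnS leq_addr.
Qed.

Lemma zsgeomP (b : zseries) : b 0%N = 0 -> zsgeom b * (1 - b) = 1.
Proof.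
move=> b0; apply: zseriesP => n.
transitivity (((\sum_(k < n.+1) b ^+ k) * (1 - b)) n).
  rewrite !zcoefM; apply: eq_bigr => i _.
  by rewrite (@zsgeom_coef _ n.+1).
rewrite mulrC -opprB mulNr -subrX1 opprB zcoefB zcoefX_small ?subr0 //.
Qed.

Lemma zsmulV : {in zsunit, left_inverse 1 zsinv *%R}.
Proof.
move=> a ua; rewrite /zsinv ua; set c := zsconst _; set b := 1 - c * a.
have b0 : b 0%N = 0.
  by rewrite /b zcoefB zcoefM0 zcoef1 /= mulr1n mulVr ?subrr.
have -> : (c * zsgeom b) * a = zsgeom b * (1 - b).
  by rewrite /b subKr mulrCA mulrA.
exact: zsgeomP.
Qed.

Lemma zsunitP (a b : zseries) : b * a = 1 -> a \in zsunit.
Proof.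
move=> ba1; have : (b * a) 0%N = 1 by rewrite ba1.
rewrite zcoefM0 => ba; apply/unitrP; exists (b 0%N).
by rewrite (mulrC (a 0%N)).
Qed.

Lemma zsinv_out : {in [predC zsunit], zsinv =1 id}.
Proof. by move=> a /=; rewrite inE /zsinv => /negPf ->. Qed.

HB.instance Definition _ := GRing.ComNzRing_hasMulInverse.Build zseries
  zsmulV zsunitP zsinv_out.

Definition q : zseries := ZSeries (fun n => (n == 1%N)%:R).

Definition qpoch (x t : zseries) (n : nat) : zseries :=
  \prod_(j < n) (1 - x * t ^+ j).

Definition Fexp (a b r s : nat) : nat :=
  (3 * r ^ 2 + 31 * r * s + 93 * s ^ 2 + a * r + b * s)%N.

Definition Fterm (a b r s : nat) : zseries :=
  q ^+ Fexp a b r s / (qpoch q q r * qpoch (q ^+ 31) (q ^+ 31) s).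

(* The sum over all r, s >= 0, taken coefficientwise: the terms with r > n or
   s > n are divisible by q^(n+1), so they do not contribute to the coefficient
   of q^n (lemma F_partial_sum). The exponents are
   restricted to a, b : nat, which keeps F a b in Z[[q]]; rational a, b would
   need fractional powers of q. *)
Definition F (a b : nat) : zseries :=
  ZSeries (fun n => \sum_(r < n.+1) \sum_(s < n.+1) Fterm a b r s n).

Definition S31 : zseries :=
  F 0 0 + q ^+ 2 * F 3 31 - q ^+ 22 * F 16 93.

Lemma qpoch_unit (x t : zseries) n : x 0%N = 0 -> qpoch x t n \is a GRing.unit.
Proof.
move=> x0; apply: rpred_prod => j _.
by rewrite unfold_in /= /zsunit zcoefB zcoefM0 x0 mul0r zcoef1 subr0.
Qed.

Lemma Fterm_denom_unit r s :
  qpoch q q r * qpoch (q ^+ 31) (q ^+ 31) s \is a GRing.unit.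
Proof. by rewrite unitrM !qpoch_unit // zcoefX_small. Qed.

Lemma Fterm_small a b r s n : (n < Fexp a b r s)%N -> Fterm a b r s n = 0.
Proof.
move=> nE; apply: (@zcoefM_small _ _ (Fexp a b r s) 0); rewrite ?addn0 //.
by move=> m; apply: zcoefX_small.
Qed.

Lemma Fexp_ge a b r s : (maxn r s <= Fexp a b r s)%N.
Proof. by rewrite /Fexp; nia. Qed.

Lemma F_partial_sum a b n N : (n < N)%N ->
  (\sum_(r < N) \sum_(s < N) Fterm a b r s) n = F a b n.
Proof.
move=> nN; rewrite zcoef_sum -(subnKC nN) big_split_ord /=.
rewrite [X in _ + X]big1 => [|r _]; last first.
  rewrite zcoef_sum big1 // => s _; apply: Fterm_small.
  by apply: leq_trans (Fexp_ge _ _ _ _) => /=; lia.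
rewrite addr0; apply: eq_bigr => r _; rewrite zcoef_sum big_split_ord /=.
rewrite [X in _ + X]big1 ?addr0 // => s _; apply: Fterm_small.
by apply: leq_trans (Fexp_ge _ _ _ _) => /=; lia.
Qed.

(* Main.v *)
Require Import Defs.
From mathcomp Require Import all_boot all_order all_algebra.
From mathcomp Require Import zify.

Import Order.TTheory GRing.Theory Num.Theory.
Local Open Scope ring_scope.

(** Multiplying the summand of F_{a,b} by 1 - q^r turns 1/(q;q)_r into
    1/(q;q)_{r-1}; shifting r gives
      F_{a,b} = F_{a+1,b} + q^{a+3} F_{a+6,b+31}.
    Applied at (3,31), (4,31) and (10,62), this recurrence gives the identity.
    Nonnegativity holds because each 1/(1-q^k) is a geometric series. *)

(** Coefficient [n] of a product sees its right factor only up to degree [n]; this lets a finite sum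
    replace [F] inside a product. *)
Lemma zcoefMl_eq (a b c : zseries) n :
  (forall i, (i <= n)%N -> b i = c i) -> (a * b) n = (a * c) n.
Proof.
by move=> bc; rewrite !zcoefM; apply: eq_bigr => i _; rewrite bc ?leq_subr.
Qed.

Lemma qpochS x t n : qpoch x t n.+1 = qpoch x t n * (1 - x * t ^+ n).
Proof. by rewrite /qpoch big_ord_recr. Qed.

Lemma Fterm_recS a b r s :
  Fterm a b r.+1 s =
  Fterm a.+1 b r.+1 s + q ^+ (a + 3) * Fterm (a + 6) (b + 31) r s.
Proof.
set d := qpoch q q r * qpoch (q ^+ 31) (q ^+ 31) s.
have Ud : d \is a GRing.unit by exact: Fterm_denom_unit.
set e := 1 - q * q ^+ r.
have dS : qpoch q q r.+1 * qpoch (q ^+ 31) (q ^+ 31) s = e * d.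
  by rewrite qpochS mulrAC mulrC.
have Ue : e \is a GRing.unit.
  by have := Fterm_denom_unit r.+1 s; rewrite dS unitrM => /andP[].
rewrite /Fterm dS -/d mulrA -exprD.
have -> : Fexp a.+1 b r.+1 s = (Fexp a b r.+1 s + r.+1)%N by rewrite /Fexp; lia.
have -> : (a + 3 + Fexp (a + 6) (b + 31) r s)%N = Fexp a b r.+1 s.
  by rewrite /Fexp; lia.
(* With equal denominators, the two terms at [r.+1] differ by a numerator factor 1 - q^(r+1), which
   is [e] and cancels against the denominator. *)
apply/eqP; rewrite addrC -subr_eq -mulrBl exprD exprS.
rewrite -{1}[q ^+ Fexp a b r.+1 s]mulr1 -mulrBr -/e.
by rewrite invrM // -mulrA [e * _]mulrC divrK.
Qed.

Lemma F_rec a b : F a b = F a.+1 b + q ^+ (a + 3) * F (a + 6) (b + 31).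
Proof.
apply: zseriesP => n; rewrite zcoefD.
(* One row more than needed: once r = 0 is split off, [n.+1] rows remain to match the shifted
   sum. *)
rewrite -!(@F_partial_sum _ b n n.+2) //.
rewrite (@zcoefMl_eq _ _
  (\sum_(r < n.+1) \sum_(s < n.+2) Fterm (a + 6) (b + 31) r s)); last first.
  move=> i ni; rewrite -(@F_partial_sum _ _ _ n.+1) // !zcoef_sum.
  apply: eq_bigr => r _; rewrite [in RHS]big_ord_recr zcoefD.
  (* The extra column s = n+1 starts at degree at least n+1 > i. *)
  rewrite [X in _ = _ + X]Fterm_small ?addr0 //.
  by apply: leq_trans (Fexp_ge _ _ _ _); rewrite leq_max ltnS ni orbT.
rewrite -zcoefD; congr (zcoef _ n).
rewrite big_ord_recl [X in _ = X + _]big_ord_recl -addrA.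
(* The r = 0 terms are convertible, since a * 0 and a.+1 * 0 are. *)
congr (_ + _).
rewrite mulr_sumr -big_split; apply: eq_bigr => r _ /=.
by rewrite mulr_sumr -big_split; apply: eq_bigr => s _; rewrite Fterm_recS.
Qed.

Lemma mulXF_rec k a b :
  q ^+ k * F a b =
  q ^+ k * F a.+1 b + q ^+ (k + (a + 3)) * F (a + 6) (b + 31).
Proof. by rewrite F_rec mulrDr mulrA -exprD. Qed.

Definition znonneg (a : zseries) := forall n, 0 <= a n.

Lemma znonneg1 : znonneg 1.
Proof. by move=> n; rewrite zcoef1 ler0n. Qed.

Lemma znonnegq : znonneg q.
Proof. by move=> n; rewrite ler0n. Qed.

Lemma znonnegD (a b : zseries) : znonneg a -> znonneg b -> znonneg (a + b).
Proof. by move=> a0 b0 n; rewrite zcoefD addr_ge0. Qed.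

Lemma znonnegM (a b : zseries) : znonneg a -> znonneg b -> znonneg (a * b).
Proof.
by move=> a0 b0 n; rewrite zcoefM; apply: sumr_ge0 => i _; apply: mulr_ge0.
Qed.

Lemma znonnegX (a : zseries) k : znonneg a -> znonneg (a ^+ k).
Proof.
move=> a0; elim: k => [|k IHk]; first exact: znonneg1.
by rewrite exprS; apply: znonnegM.
Qed.

Lemma znonneg_geom (b : zseries) : b 0%N = 0 -> znonneg b -> znonneg (1 - b)^-1.
Proof.
move=> b00 b0; have gb := zsgeomP b00.
have U : 1 - b \is a GRing.unit.
  by apply/unitrP; exists (zsgeom b); split; rewrite // mulrC.
have -> : (1 - b)^-1 = zsgeom b by apply: (mulIr U); rewrite mulVr // gb.
move=> n; rewrite [zsgeom b n]zcoef_sum.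
by apply: sumr_ge0 => k _; apply: znonnegX.
Qed.

(** The factors are inverted one at a time; since [x] has zero constant term, so does each x t^j,
    and the geometric series applies. *)
Lemma znonneg_qpochV (x t : zseries) n :
  x 0%N = 0 -> znonneg x -> znonneg t -> znonneg (qpoch x t n)^-1.
Proof.
move=> x00 x0 t0; elim: n => [|n IHn].
  by rewrite /qpoch big_ord0 invr1; apply: znonneg1.
have := qpoch_unit t n.+1 x00; rewrite qpochS unitrM => /andP[Un Ux].
rewrite invrM //; apply: znonnegM IHn; apply: znonneg_geom.
  by rewrite zcoefM0 x00 mul0r.
by apply: znonnegM => //; apply: znonnegX.
Qed.

Lemma znonneg_Fterm a b r s : znonneg (Fterm a b r s).
Proof.
have q0 k : znonneg (q ^+ k) by exact/znonnegX/znonnegq.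
have := Fterm_denom_unit r s; rewrite unitrM => /andP[Ur Us].
rewrite /Fterm invrM //; apply: znonnegM => //.
by apply: znonnegM; apply: znonneg_qpochV; rewrite ?zcoefX_small //;
  exact: znonnegq.
Qed.

Lemma znonneg_F a b : znonneg (F a b).
Proof.
by move=> n /=; do 2! [apply: sumr_ge0 => ? _]; apply: znonneg_Fterm.
Qed.

Theorem proposition5p2 :
  S31 = F 0 0 + q ^+ 2 * F 5 31 + q ^+ 8 * F 9 62 + q ^+ 9 * F 11 62
  /\ (forall n : nat, 0 <= S31 n).
Proof.
have S31E :
  S31 = F 0 0 + q ^+ 2 * F 5 31 + q ^+ 8 * F 9 62 + q ^+ 9 * F 11 62.
  (* The new powers are 2+3+3 = 8, 2+4+3 = 9 and 9+10+3 = 22; the last term produced is exactly the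
     one subtracted in [S31]. *)
  have r3 : q ^+ 2 * F 3 31 = q ^+ 2 * F 4 31 + q ^+ 8 * F 9 62.
    exact: (mulXF_rec 2 3 31).
  have r4 : q ^+ 2 * F 4 31 = q ^+ 2 * F 5 31 + q ^+ 9 * F 10 62.
    exact: (mulXF_rec 2 4 31).
  have r10 : q ^+ 9 * F 10 62 = q ^+ 9 * F 11 62 + q ^+ 22 * F 16 93.
    exact: (mulXF_rec 9 10 62).
  (* Variables stand for the series: rewriting with concrete powers of q makes
     unification unfold them. *)
  have telescope (x a b c d e f g : zseries) :
      a = b + c -> b = d + e -> e = f + g -> x + a - g = x + d + c + f.
    by move=> -> -> ->; rewrite [d + _]addrA [_ + g + c]addrAC !addrA addrK addrAC.
  exact: telescope r3 r4 r10.
(* The four-term form has no minus sign, so nonnegativity passes to the sum. *)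
split=> //; rewrite S31E.
have qF k a b : znonneg (q ^+ k * F a b).
  by apply: znonnegM; [exact/znonnegX/znonnegq|exact: znonneg_F].
by do 3! apply: znonnegD => //; apply: znonneg_F.
Qed.
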